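(* For each $n\ge 1$ and each $w\in S_n$, the oriented graph $\bar X_w$ has a unique sink, and this sink is (the equivalence class of) a reduced expression for $w$.
   Context: Let $s_1,\dots,s_{n-1}$ be the simple reflections of $S_n$. An expression for $w\in S_n$ is a finite word in $s_1,\dots,s_{n-1}$, not necessarily reduced, whose product is $w$. $X_w$ is the set of all expressions for $w$. Two expressions are equivalent if they differ by a sequence of commuting relations $s_is_j=s_js_i$ with $|i-j|>1$ applied to subwords. $\bar X_w$ is the set of equivalence classes $[\underline{w}]$ of expressions $\underline{w}\in X_w$, made into an oriented graph as follows: there is an edge from $[\underline{w}]$ to $[\underline{w}']$ if there are representatives of the two classes such that the second is obtained from the first by replacing a subword (of consecutive letters) $s_is_{i+1}s_i$ by $s_{i+1}s_is_{i+1}$, or by deleting a subword $s_is_i$. A sink is a vertex with no outgoing edge. *)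

(* Defs.v *)
From Stdlib Require Import Relations.
From mathcomp Require Import all_boot all_fingroup.
From mathcomp Require Import generic_quotient boolp.

Set Implicit Arguments.
Unset Strict Implicit.
Unset Printing Implicit Defensive.

Local Open Scope quotient_scope.

Lemma letter_lt n (i : 'I_n.-1) : i < n.
Proof. by case: n i => [|n] [i] //= /ltnW. Qed.

Lemma letter_succ_lt n (i : 'I_n.-1) : i.+1 < n.
Proof. by case: n i => [|n] []. Qed.

(* Indices start at 0: the points permuted are 0, ..., n - 1, and the letter
   i : 'I_n.-1 is the simple reflection s_(i+1), swapping i and i + 1. *)
Definition simple_refl n (i : 'I_n.-1) : 'S_n :=
  tperm (Ordinal (letter_lt i)) (Ordinal (letter_succ_lt i)).

Definition word n := seq 'I_n.-1.

(* Products in 'S_n compose from left to right; the opposite convention would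
   only exchange the expressions for w with those for w^-1. *)
Definition expr n (w : 'S_n) :=
  {u : word n | (\prod_(i <- u) simple_refl i)%g == w}.

Definition reduced n (w : 'S_n) (u : expr w) : Prop :=
  forall v : expr w, size (val u) <= size (val v).

Inductive comm_step n : word n -> word n -> Prop :=
  CommStep (u v : word n) (i j : 'I_n.-1) of (i.+1 < j) || (j.+1 < i) :
    comm_step (u ++ [:: i; j] ++ v) (u ++ [:: j; i] ++ v).

Definition comm_equiv n (w : 'S_n) : rel (expr w) :=
  fun u v => `[< clos_refl_sym_trans _ (@comm_step n) (val u) (val v) >].

Lemma comm_equiv_refl n (w : 'S_n) : reflexive (@comm_equiv n w).
Proof. by move=> u; apply/asboolP; exact: rst_refl. Qed.

Lemma comm_equiv_sym n (w : 'S_n) : symmetric (@comm_equiv n w).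
Proof. by move=> u v; apply/asboolP/asboolP => h; exact: rst_sym. Qed.

Lemma comm_equiv_trans n (w : 'S_n) : transitive (@comm_equiv n w).
Proof.
by move=> v u t /asboolP uv /asboolP vt; apply/asboolP; exact: rst_trans vt.
Qed.

Canonical comm_equivRel n (w : 'S_n) :=
  EquivRel (@comm_equiv n w) (@comm_equiv_refl n w) (@comm_equiv_sym n w)
    (@comm_equiv_trans n w).

Definition Xbar n (w : 'S_n) := {eq_quot @comm_equiv n w}.

Definition expr_class n (w : 'S_n) (u : expr w) : Xbar w :=
  \pi_({eq_quot @comm_equiv n w}) u.

Inductive rewrite_step n : word n -> word n -> Prop :=
| BraidStep (u v : word n) (i j : 'I_n.-1) of j = i.+1 :> nat :
    rewrite_step (u ++ [:: i; j; i] ++ v) (u ++ [:: j; i; j] ++ v)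
| DeleteStep (u v : word n) (i : 'I_n.-1) :
    rewrite_step (u ++ [:: i; i] ++ v) (u ++ v).

Definition edge n (w : 'S_n) (C D : Xbar w) : Prop :=
  exists u v : expr w,
    [/\ expr_class u = C, expr_class v = D & rewrite_step (val u) (val v)].

Definition sink n (w : 'S_n) (C : Xbar w) : Prop :=
  forall D : Xbar w, ~ edge C D.

(* Main.v *)
Require Import Defs.
From Stdlib Require Import Relations.
From mathcomp Require Import all_boot all_fingroup.
From mathcomp Require Import generic_quotient boolp zify.

(** Call a word irreducible when no word in its commutation class contains a
    factor [i i] or [i (i+1) i]; the classes of irreducible expressions are
    exactly the sinks.

    Uniqueness.  An irreducible word whose letters are all at least [k] has,
    up to commutation, the form [m (m-1) ... k] followed by letters greater
    than [k] ([split_run]).  The point is that [k] occurs at most once: by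
    induction, the letters strictly between two occurrences of [k] can be
    arranged as a descending run ending in [k+1], followed by letters that
    commute with [k], so that either [k k] or [k (k+1) k] appears
    ([letter_once]).  Since the letters after the leading run fix the point
    [k], the length of that run is determined by where the inverse of the
    permutation sends [k].  So two irreducible words with the same product
    have the same leading run; cancelling it and passing from [k] to [k+1]
    shows that they differ by commutations only
    ([irreducible_comm_unique]).

    Existence.  Among the expressions of minimal length take one whose letters
    have the largest sum.  A deletion would shorten it and a braid step would
    raise the sum, while commutations change neither; so it is irreducible
    ([exists_reduced_irreducible]). *)

Set Implicit Arguments.
Unset Strict Implicit.
Unset Printing Implicit Defensive.

Local Notation "u ~c v" := (clos_refl_sym_trans _ (@comm_step _) u v)
  (at level 70).

(** * Commutation classes of words *)

Lemma comm_cat n (a b u v : word n) : u ~c v -> a ++ u ++ b ~c a ++ v ++ b.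
Proof.
elim=> [_ _ [x y i j ij] | x | x y _ | x y z _ xy _ yz].
- rewrite -!(catA x) !(catA a x) -!(catA _ y b).
  by apply: rst_step; apply: CommStep.
- exact: rst_refl.
- exact: rst_sym.
- exact: rst_trans yz.
Qed.

Lemma comm_catl n (a u v : word n) : u ~c v -> a ++ u ~c a ++ v.
Proof. by move=> /(comm_cat a [::]); rewrite !cats0. Qed.

Lemma comm_catr n (b u v : word n) : u ~c v -> u ++ b ~c v ++ b.
Proof. exact: (@comm_cat n [::]). Qed.

Lemma comm_perm_eq n (u v : word n) : u ~c v -> perm_eq u v.
Proof.
elim=> [_ _ [x y i j _] | x | x y _ | x y z _ xy _ yz] //.
- by rewrite perm_cat2l perm_cat2r (perm_catC [:: i] [:: j]).
- by rewrite perm_sym.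
- exact: perm_trans yz.
Qed.

Lemma comm_size n (u v : word n) : u ~c v -> size u = size v.
Proof. by move=> /comm_perm_eq /perm_size. Qed.

Lemma rewrite_step_cat n (a b u v : word n) :
  rewrite_step u v -> rewrite_step (a ++ u ++ b) (a ++ v ++ b).
Proof.
case=> [x y i j ij | x y i]; rewrite -!(catA x) !(catA a x) -!(catA _ y b).
- exact: BraidStep.
- exact: DeleteStep.
Qed.

(** * The permutation expressed by a word *)

Definition eval n (u : word n) : 'S_n := (\prod_(i <- u) simple_refl i)%g.

Lemma eval_cat n (u v : word n) : eval (u ++ v) = (eval u * eval v)%g.
Proof. exact: big_cat. Qed.

Lemma eval_seq1 n (i : 'I_n.-1) : eval [:: i] = simple_refl i.
Proof. exact: big_seq1. Qed.

Lemma simple_reflL n (i : 'I_n.-1) (p : 'I_n) :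
  p = i :> nat -> simple_refl i p = i.+1 :> nat.
Proof.
move=> pi; rewrite /simple_refl.
by rewrite (_ : p = Ordinal (letter_lt i)) ?tpermL //; apply: val_inj.
Qed.

Lemma simple_reflD n (i : 'I_n.-1) (p : 'I_n) :
  p != i :> nat -> p != i.+1 :> nat -> simple_refl i p = p.
Proof.
move=> pi pj; rewrite /simple_refl tpermD //.
- by apply: contraNneq pi => <-.
- by apply: contraNneq pj => <-.
Qed.

Lemma simple_refl2 n (i : 'I_n.-1) : (simple_refl i * simple_refl i = 1)%g.
Proof. exact: tperm2. Qed.

Lemma simple_reflV n (i : 'I_n.-1) : ((simple_refl i)^-1 = simple_refl i)%g.
Proof. exact: tpermV. Qed.

Lemma simple_refl_comm n (i j : 'I_n.-1) :
  (i.+1 < j) || (j.+1 < i) ->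
  (simple_refl i * simple_refl j = simple_refl j * simple_refl i)%g.
Proof.
move=> ij; rewrite conjgC [(simple_refl i ^ _)%g]tpermJ !tpermD //;
  by rewrite -val_eqE /=; lia.
Qed.

(** Both sides are the transposition of [i] and [i + 2]. *)
Lemma simple_refl_braid n (i j : 'I_n.-1) :
  j = i.+1 :> nat ->
  (simple_refl i * simple_refl j * simple_refl i =
   simple_refl j * simple_refl i * simple_refl j)%g.
Proof.
move=> ij.
set a := Ordinal (letter_lt i); set b := Ordinal (letter_succ_lt i).
set c := Ordinal (letter_succ_lt j).
have eb : Ordinal (letter_lt j) = b by apply: val_inj.
have ab : a != b by rewrite -val_eqE /=; lia.
have ac : a != c by rewrite -val_eqE /=; lia.
have bc : b != c by rewrite -val_eqE /=; lia.
rewrite /simple_refl eb -/a -/b -/c.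
transitivity (tperm a c).
- by rewrite -mulgA -{1}(tpermV a b) -conjgE tpermJ tpermR tpermD.
- by rewrite -mulgA -{1}(tpermV b c) -conjgE tpermJ tpermL tpermD // eq_sym.
Qed.

Lemma comm_eval n (u v : word n) : u ~c v -> eval u = eval v.
Proof.
elim=> [_ _ [x y i j ij] | // | x y _ -> // | x y z _ -> _ -> //].
by rewrite !eval_cat /eval !big_cons big_nil !mulg1 simple_refl_comm.
Qed.

Lemma rewrite_step_eval n (u v : word n) : rewrite_step u v -> eval u = eval v.
Proof.
case=> [x y i j ij | x y i]; rewrite !eval_cat /eval !big_cons big_nil mulg1.
- by rewrite mulg1 !(mulgA (simple_refl _)) simple_refl_braid.
- by rewrite simple_refl2 mul1g.
Qed.

(** * Irreducible words *)

Definition irreducible n (u : word n) :=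
  forall x y : word n, u ~c x -> ~ rewrite_step x y.

Lemma irreducible_comm n (u v : word n) :
  u ~c v -> irreducible u -> irreducible v.
Proof. by move=> uv iu x y vx; apply: iu; apply: rst_trans vx. Qed.

Lemma irreducible_factor n (a u b : word n) :
  irreducible (a ++ u ++ b) -> irreducible u.
Proof.
move=> iu x y ux xy.
exact: iu (comm_cat a b ux) (rewrite_step_cat a b xy).
Qed.

Definition letters_ge n k (u : word n) := all (fun i : 'I_n.-1 => k <= i) u.

Lemma letters_ge_cat n k (u v : word n) :
  letters_ge k (u ++ v) = letters_ge k u && letters_ge k v.
Proof. exact: all_cat. Qed.

Lemma letters_geS n k (u : word n) : letters_ge k.+1 u -> letters_ge k u.
Proof. by apply: sub_all => i /ltnW. Qed.

(** * Splitting off a descending run *)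

Lemma comm_letter n (i : 'I_n.-1) (u : word n) :
  letters_ge i.+2 u -> u ++ [:: i] ~c i :: u.
Proof.
elim: u => [_ | j u IHu] /=; first exact: rst_refl.
case/andP=> ij /IHu /(comm_catl [:: j]) h; apply: rst_trans h _.
by apply/rst_step/(CommStep [::] u); rewrite ij orbT.
Qed.

(** A run is [k + l - 1, ..., k + 1, k]; its length [l] may be zero, which
    covers the words in which [k] does not occur. *)
Definition run n k (d : word n) : bool :=
  [seq val i | i <- d] == rev (iota k (size d)).

Lemma run_rcons n (d : word n) (i : 'I_n.-1) k :
  run k (rcons d i) = run k.+1 d && (i == k :> nat).
Proof. by rewrite /run size_rcons map_rcons /= rev_cons eqseq_rcons. Qed.

Lemma run_letters_ge n k (d : word n) : run k d -> letters_ge k d.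
Proof.
move=> /eqP rd; apply/allP => i id.
have : val i \in rev (iota k (size d)) by rewrite -rd map_f.
by rewrite mem_rev mem_iota => /andP[].
Qed.

Lemma run_inj n k (d e : word n) :
  run k d -> run k e -> size d = size e -> d = e.
Proof.
by move=> /eqP rd /eqP re sde; apply: (inj_map val_inj); rewrite rd re sde.
Qed.

(** Reading the run from its last letter, the inverse moves the point [k] one
    step up per letter. *)
Lemma eval_run n k (d : word n) (p : 'I_n) :
  run k d -> p = k :> nat -> ((eval d)^-1 p)%g = k + size d :> nat.
Proof.
elim/last_ind: d k p => [|d i IHd] k p.
  by rewrite /eval big_nil invg1 perm1 addn0.
rewrite run_rcons => /andP[rd /eqP ik] pk.
rewrite -cats1 eval_cat invMg permM eval_seq1 simple_reflV.
rewrite (IHd k.+1) ?size_cat ?addn1 ?addSnnS //.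
by rewrite simple_reflL ik.
Qed.

Lemma eval_fix n k (u : word n) (p : 'I_n) :
  letters_ge k.+1 u -> p = k :> nat -> ((eval u)^-1 p)%g = p.
Proof.
move=> + pk; elim: u => [|i u IHu] /=.
  by rewrite /eval big_nil invg1 perm1.
case/andP=> ki /IHu up; rewrite -cat1s eval_cat invMg permM up eval_seq1.
by rewrite simple_reflV simple_reflD // pk; lia.
Qed.

(** Moving the second [i] to the left through [r] brings it next to [d].  If
    [d] is empty this exposes [i i].  Otherwise [d] ends in [k+1], and the rest
    of [d] commutes with the first [i]; moving that rest to the front exposes
    [i (i+1) i]. *)
Lemma letter_once n k (i : 'I_n.-1) (d r : word n) :
  i = k :> nat -> run k.+1 d -> letters_ge k.+2 r ->
  ~ irreducible (i :: (d ++ r) ++ [:: i]).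
Proof.
move=> ik rd gr irr.
have h1 : i :: (d ++ r) ++ [:: i] ~c i :: d ++ i :: r.
  rewrite -catA; apply: (@comm_catl _ (i :: d)); apply: comm_letter.
  by rewrite ik.
elim/last_ind: d rd h1 {irr} (irreducible_comm h1 irr) => [|e j _] rd _ irr.
  exact: (irr _ _ (rst_refl _ _ _) (DeleteStep [::] r i)).
move: rd; rewrite run_rcons => /andP[/run_letters_ge ge /eqP jk].
have h2 : i :: rcons e j ++ i :: r ~c e ++ [:: i; j; i] ++ r.
  apply: rst_sym; rewrite -cats1 -catA /= -cat1s catA.
  apply: (@comm_catr _ (j :: i :: r) _ (i :: e)).
  by apply: comm_letter; rewrite ik.
by apply: irr h2 (BraidStep e r (i := i) (j := j) _); rewrite jk ik.
Qed.

(** Cut [u] at the first letter [k], as [A k B].  Splitting [A] by induction at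
    [k+1], with [k] commuting past the remainder of [A], gives a run down to
    [k].  What follows could contain [k] only through [B], and a second [k] is
    excluded by [letter_once]. *)
Lemma split_run n k (u : word n) :
  irreducible u -> letters_ge k u ->
  exists d r, [/\ u ~c d ++ r, run k d & letters_ge k.+1 r].
Proof.
have [m] := ubnP (size u); elim: m => // m IHm in k u *.
rewrite ltnS => um iu gu.
have [gu'|] := boolP (letters_ge k.+1 u).
  by exists [::], u; split=> //; exact: rst_refl.
rewrite -has_predC => /split_find uAB.
case: uAB um iu gu => i A B /=; rewrite -leqNgt => ik.
rewrite has_predC negbK -cats1 -catA /= => gA.
rewrite size_cat letters_ge_cat /= => um iu.
case/and3P=> _ ki gB; have {ki} ik : i = k :> nat by lia.
(* A contains only letters above k, so it is split one level higher. *)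
have [||d [A' [Ad rd gA']]] := IHm k.+1 A _ _ gA.
- by lia.
- exact: (@irreducible_factor _ [::] A (i :: B)).
have iB : irreducible B.
  by apply: (@irreducible_factor _ (A ++ [:: i]) B [::]); rewrite cats0 -catA.
have [|e [B' [Be re gB']]] := IHm k B _ iB gB; first by lia.
have uAB : A ++ i :: B ~c d ++ (i :: A') ++ (e ++ B').
  apply: rst_trans (comm_catr _ Ad) _.
  apply: rst_trans (comm_catl (_ ++ _) (comm_catl [:: i] Be)) _.
  rewrite -!catA; apply: comm_catl; rewrite catA; apply: comm_catr.
  by apply: comm_letter; rewrite ik.
(* The letter k occurs in B exactly when the run e of B is nonempty. *)
case/lastP: e re Be uAB => [|e j] re Be uAB.
  exists (rcons d i), (A' ++ B'); rewrite run_rcons rd ik eqxx.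
  by rewrite letters_ge_cat letters_geS // gB' cat_rcons.
move: re Be uAB; rewrite run_rcons => /andP[re /eqP jk] Be.
have {jk} <- : i = j by apply: val_inj; rewrite /= ik jk.
rewrite (_ : (i :: A') ++ _ = (i :: (A' ++ e) ++ [:: i]) ++ B'); last first.
  by rewrite -cats1 /= -!catA.
move=> uAB; have iu' := irreducible_factor (irreducible_comm uAB iu).
(* The letters between the two k are brought to the form required by
   letter_once. *)
have iAe : irreducible (A' ++ e)
  by apply: (@irreducible_factor _ [:: i] _ [:: i]).
have [||f [r [Af rf gr]]] := IHm k.+1 (A' ++ e) _ iAe.
- apply: leq_trans um; rewrite (comm_size Ad) (comm_size Be) !size_cat.
  by rewrite size_rcons; lia.
- by rewrite letters_ge_cat letters_geS // run_letters_ge.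
case: (letter_once ik rf gr).
exact: irreducible_comm (comm_cat [:: i] [:: i] Af) iu'.
Qed.

(** * Irreducible words are determined by their product *)

(** The leading runs have the same length, because it is read off from the
    image of [k] under the inverse of the common product. *)
Lemma irreducible_comm_unique n k (u v : word n) :
  irreducible u -> irreducible v -> letters_ge k u -> letters_ge k v ->
  eval u = eval v -> u ~c v.
Proof.
have [m] := ubnP (n - k); elim: m => // m IHm in k u v *; rewrite ltnS => km.
have [kn|nk] := ltnP k n; last first.
  case: u => [|i u] _; last by move=> _ /andP[ki]; have := letter_lt i; lia.
  case: v => [|i v] _; last by move=> _ /andP[ki]; have := letter_lt i; lia.
  by move=> *; apply: rst_refl.
move=> iu iv /(split_run iu)[d [r [udr rd gr]]].
move=> /(split_run iv)[e [s [ves re gs]]].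
rewrite (comm_eval udr) (comm_eval ves) !eval_cat => evals.
have pos (f t : word n) : run k f -> letters_ge k.+1 t ->
    ((eval f * eval t)^-1 (Ordinal kn))%g = k + size f :> nat.
  by move=> rf gt; rewrite invMg permM (eval_fix gt) // (eval_run rf).
have sde : size d = size e.
  by apply/eqP; rewrite -(eqn_add2l k) -(pos d r) // evals pos.
have de := run_inj rd re sde; rewrite -{}de {e sde re} in ves evals.
apply: rst_trans (udr) _; apply: rst_trans (rst_sym _ _ _ _ ves).
apply/comm_catl/(IHm k.+1) => //; last exact: mulgI evals.
- by lia.
- by apply: (@irreducible_factor _ d _ [::]); rewrite cats0;
    apply: irreducible_comm udr iu.
- by apply: (@irreducible_factor _ d _ [::]); rewrite cats0;
    apply: irreducible_comm ves iv.
Qed.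

(** * Existence of a reduced irreducible expression *)

(** Conjugating the transposition of [x + 1] and [y] by the simple reflection
    at [x] gives the transposition of [x] and [y]. *)
Lemma eval_tperm n (x y : 'I_n) : exists u : word n, eval u = tperm x y.
Proof.
wlog xy : x y / x <= y => [hw|].
  by have [/hw //|/ltnW /hw[u eu]] := leqP x y; exists u; rewrite tpermC.
have [m] := ubnP (y - x); elim: m => // m IHm in x y xy *; rewrite ltnS => xym.
have [->|nxy] := eqVneq x y.
  by exists [::]; rewrite tperm1 /eval big_nil.
have {xy nxy} xy : x < y by rewrite ltn_neqAle xy andbT.
have lt : x < n.-1 by have := ltn_ord y; lia.
have lt' : x.+1 < n by lia.
pose i := Ordinal lt; pose z := Ordinal lt'.
have si : simple_refl i = tperm x z by congr tperm; apply: val_inj.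
have [->|zy] := eqVneq y z; first by exists [:: i]; rewrite eval_seq1 si.
have [||u eu] := IHm z y; rewrite /=; [lia|lia|].
exists ([:: i] ++ u ++ [:: i]).
rewrite !eval_cat !eval_seq1 si eu -{1}(tpermV x z) -conjgE tpermJ tpermR.
by rewrite tpermD // ?(eq_sym z) // -val_eqE /=; lia.
Qed.

Lemma eval_surj n (w : 'S_n) : exists u : word n, eval u = w.
Proof.
have [ts -> _] := prod_tpermP w; elim: ts => [|t ts [u eu]].
  by exists [::]; rewrite /eval !big_nil.
by have [v ev] := eval_tperm t.1 t.2; exists (v ++ u);
  rewrite eval_cat big_cons eu ev.
Qed.

Lemma expr_eval n (w : 'S_n) (u : expr w) : eval (val u) = w.
Proof. by apply/eqP; exact: (valP u). Qed.

(** Commutations only permute the letters, so they preserve both the length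
    and the sum that are optimised; the sum has a maximum because the length
    has already been fixed. *)
Lemma exists_reduced_irreducible n (w : 'S_n) :
  exists u : expr w, reduced u /\ irreducible (val u).
Proof.
have [u0 /eqP eu0] := eval_surj w.
pose has_size m := `[< exists u : expr w, size (val u) = m >].
have exs : exists m, has_size m.
  by exists (size u0); apply/asboolP; exists (exist _ u0 eu0).
have [l /asboolP[v vl] lmin] := ex_minnP exs.
have red (u : expr w) : size (val u) = l -> reduced u.
  by move=> ul x; rewrite ul; apply: lmin; apply/asboolP; exists x.
pose has_sum m :=
  `[< exists2 u : expr w, size (val u) = l & \sum_(i <- val u) val i = m >].
have exm : exists m, has_sum m.
  by exists (\sum_(i <- val v) val i); apply/asboolP; exists v.
have bound m : has_sum m -> m <= l * n.
  case/asboolP=> u <- <-; elim: (val u) => [|i x IHx]; first by rewrite big_nil.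
  by rewrite big_cons mulSn leq_add // ltnW ?letter_lt.
have [m /asboolP[u ul um] mmax] := ex_maxnP exm bound.
exists u; split=> [|x y ux xy]; first exact: red.
have [z zy] : exists z : expr w, val z = y.
  have ey : eval y == w.
    by rewrite -(rewrite_step_eval xy) -(comm_eval ux) expr_eval.
  by exists (exist _ y ey).
have xl : size x = l by rewrite -ul (comm_size ux).
have xm : \sum_(i <- x) val i = m by rewrite -um (perm_big _ (comm_perm_eq ux)).
case: xy zy xl xm => [a b i j ij | a b i] zy.
- rewrite !size_cat !big_cat !big_cons big_nil /= => xl xm.
  have : has_sum m.+1; last by move/mmax; rewrite ltnn.
  apply/asboolP; exists z; rewrite zy ?size_cat //=.
  by rewrite !big_cat !big_cons /=; lia.
- by have := red u ul z; rewrite zy ul !size_cat /=; lia.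
Qed.

(** * Sinks of the graph *)

Lemma expr_classP n (w : 'S_n) (u v : expr w) :
  expr_class u = expr_class v <-> val u ~c val v.
Proof.
by split=> [/eqmodP /asboolP | uv]; last by apply/eqmodP/asboolP.
Qed.

Lemma sink_irreducible n (w : 'S_n) (u : expr w) :
  sink (expr_class u) <-> irreducible (val u).
Proof.
split=> [su x y ux xy | iu D [x [y [xu _ xy]]]].
- have ex : eval x == w by rewrite -(comm_eval ux) expr_eval.
  have ey : eval y == w by rewrite -(rewrite_step_eval xy).
  apply: (su (expr_class (exist _ y ey : expr w))).
  exists (exist _ x ex), (exist _ y ey); split=> //.
  by apply/expr_classP/rst_sym.
- by apply: iu xy; apply/expr_classP.
Qed.

Theorem theorem3p27 (n : nat) (hn : 1 <= n) (w : 'S_n) :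
  exists C : Xbar w,
    [/\ sink C,
        forall D : Xbar w, sink D -> D = C
      & exists u : expr w, reduced u /\ expr_class u = C].
Proof.
have [u [ru iu]] := exists_reduced_irreducible w.
exists (expr_class u); split; [exact/sink_irreducible | | by exists u].
elim/quotP=> v _ /sink_irreducible iv; apply/expr_classP.
apply: (@irreducible_comm_unique n 0) => //; try exact/allP.
by rewrite !expr_eval.
Qed.
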